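(* Let $1<\alpha\le 2$, $\theta\in\mathbb{R}$ with $|\theta|\le\min\{\alpha,2-\alpha\}$, $\nu\in\mathbb{R}$ and $d>0$ be constants, and let $g_0,f_1,f_2\in L^2(\mathbb{R})$ be real-valued. For $j=1,2$ let $u_j$ be a solution of $$\frac{\partial u_j(x,t)}{\partial t}=-\nu\frac{\partial u_j(x,t)}{\partial x}+d\,D^\alpha_\theta u_j(x,t)+f_j(x),\quad x\in\mathbb{R},\ t>0,\qquad u_j(x,0)=g_0(x).$$ If $f_1=f_2$, then $u_1=u_2$.
   Context: The Fourier transform in $x$ is $\hat h(k)=\int_{-\infty}^{+\infty}h(y)e^{iky}\,dy$ (extended to $L^2(\mathbb{R})$ as usual), with inverse $h(x)=\frac1{2\pi}\int_{-\infty}^{+\infty}\hat h(k)e^{-ikx}\,dk$. The symbol $\psi^\alpha_\theta(k)=|k|^\alpha e^{i\,\mathrm{sign}(k)\,\theta\pi/2}$ is used, with $\psi^\alpha_\theta(0)=0$. The Riesz-Feller fractional derivative $D^\alpha_\theta$ of order $\alpha$ and skewness $\theta$ in the variable $x$ is the operator with Fourier symbol $-\psi^\alpha_\theta$: the Fourier transform of $D^\alpha_\theta c(\cdot,t)$ is $-\psi^\alpha_\theta(k)\hat c(k,t)$. With this convention the Fourier transform of $\partial_x c$ is $-ik\,\hat c$. Solutions of the problem with source $f$ are understood in the Fourier sense: $u(\cdot,t)\in L^2(\mathbb{R})$ for every $t\ge 0$ with $u(\cdot,0)=g_0$, and there is a measurable function $\hat u(k,t)$ on $\mathbb{R}\times[0,\infty)$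 which for every $t\ge0$ coincides for almost every $k$ with the Fourier transform of $u(\cdot,t)$, and such that for almost every $k$ the map $t\mapsto\hat u(k,t)$ is continuous on $[0,\infty)$, differentiable on $(0,\infty)$, and satisfies $\partial_t\hat u(k,t)=(i\nu k-d\,\psi^\alpha_\theta(k))\hat u(k,t)+\hat f(k)$ for $t>0$, with $\hat u(k,0)=\hat g_0(k)$. Equality of functions in $L^2(\mathbb{R})$ is equality almost everywhere; $u_1=u_2$ means $u_1(\cdot,t)=u_2(\cdot,t)$ for every $t\ge0$. *)

(* Defs.v *)
From mathcomp Require Export all_boot all_order all_algebra.
From mathcomp Require Export all_classical all_reals all_analysis.
From mathcomp Require Export complex.

Set Implicit Arguments.
Unset Strict Implicit.
Unset Printing Implicit Defensive.

Import Order.TTheory GRing.Theory Num.Theory.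
Import numFieldNormedType.Exports.

Local Open Scope classical_set_scope.
Local Open Scope ring_scope.
Local Open Scope complex_scope.

(* Plain Re and Im would be the R[i]-valued ones of numClosedFieldType. *)
Local Notation Re := (@complex.Re _).
Local Notation Im := (@complex.Im _).

Section Defs.
Context {R : realType}.
Implicit Types (h F f : R -> R[i]) (k x y t a : R).

Notation mu := (@lebesgue_measure R).

Definition cexpi a : R[i] := cos a +i* sin a.

Definition cL1 h : Prop :=
  (Re \o h) \in Lfun mu 1%:E /\ (Im \o h) \in Lfun mu 1%:E.

Definition cL2 h : Prop :=
  (Re \o h) \in Lfun mu 2%:E /\ (Im \o h) \in Lfun mu 2%:E.

Definition L2dist h F : \bar R :=
  'N[mu]_2%:E[EFin \o (fun x => ComplexField.Normc.normc (h x - F x)%R)]%E.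

Definition cintegral h : R[i] :=
  (\int[mu]_x Re (h x)) +i* (\int[mu]_x Im (h x)).

Definition fourierL1 h : R -> R[i] :=
  fun k => cintegral (fun y => h y * cexpi (k * y)).

(* The extension to L^2 by density of L^1 `&` L^2: F represents the transform
   of h when (h, F) is an L^2 x L^2 limit of pairs (h_n, fourierL1 h_n) with
   every h_n in L^1 `&` L^2.  A relation rather than a function, since the
   transform is only determined up to a null set. *)
Definition is_fourierL2 h F : Prop :=
  [/\ cL2 h, cL2 F &
    exists h_ : nat -> R -> R[i],
      [/\ forall n, cL1 (h_ n) /\ cL2 (h_ n),
          L2dist (h_ n) h @[n --> \oo] --> 0%E &
          L2dist (fourierL1 (h_ n)) F @[n --> \oo] --> 0%E]].

(* At k = 0 this is 0 as soon as alpha != 0, since 0 `^ alpha = 0 then. *)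
Definition psi (alpha theta k : R) : R[i] :=
  (`|k| `^ alpha)%:C * cexpi (Num.sg k * (theta * pi / 2)).

Definition cmeasurable_fun d (T : measurableType d) (D : set T)
    (w : T -> R[i]) : Prop :=
  measurable_fun D (Re \o w) /\ measurable_fun D (Im \o w).

Definition ccontinuous_on (D : set R) (w : R -> R[i]) : Prop :=
  {within D, continuous (Re \o w)} /\ {within D, continuous (Im \o w)}.

Definition is_cderive t (w : R -> R[i]) (l : R[i]) : Prop :=
  is_derive t 1 (Re \o w) (Re l) /\ is_derive t 1 (Im \o w) (Im l).

(* Both u and uhat are functions of (space or frequency) first, time second. *)
Definition fourier_solution (alpha theta nu d : R) (g0 f : R -> R[i])
    (u : R -> R -> R[i]) : Prop :=
  [/\ forall t, 0 <= t -> cL2 (u ^~ t),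
      {ae mu, forall x, u x 0 = g0 x} &
      exists uhat : R -> R -> R[i], exists ghat fhat : R -> R[i],
        [/\ is_fourierL2 g0 ghat /\ is_fourierL2 f fhat,
            cmeasurable_fun
              (T := (measurableTypeR R * measurableTypeR R)%type)
              ([set: R] `*` `[0, +oo[) (fun p => uhat p.1 p.2),
            forall t, 0 <= t -> is_fourierL2 (u ^~ t) (uhat ^~ t) &
            {ae mu, forall k,
              [/\ ccontinuous_on `[0, +oo[ (uhat k),
                  forall t, 0 < t ->
                    is_cderive t (uhat k)
                      ((0 +i* (nu * k) - d%:C * psi alpha theta k) * uhat k t
                       + fhat k) &
                  uhat k 0 = ghat k]}]].

End Defs.

(* Main.v *)
Require Import Defs.
From mathcomp Require Import measurable_realfun.
From mathcomp Require Import ring lra.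

Set Implicit Arguments.
Unset Strict Implicit.
Unset Printing Implicit Defensive.

Import Order.TTheory GRing.Theory Num.Theory.
Import numFieldNormedType.Exports.

Local Open Scope classical_set_scope.
Local Open Scope ring_scope.
Local Open Scope complex_scope.

(* Both transforms are controlled by duality. By Fubini and the integral of
   [exp(-e|k|) exp(ikz)], every [h] in [L^1] satisfies
     [\int hhat(k) exp(-e|k|) exp(-ikx) dk = \int h(y) 2e/(e^2 + (y-x)^2) dy],
   and both sides pass to [L^2] limits by Cauchy-Schwarz. A square-integrable
   function all of whose Poisson integrals vanish is zero almost everywhere, so
   the [L^2] transform determines the function. Conversely the identity, applied
   to [exp(-|k|)] times the difference of two transforms of one function, shows
   that the transform is unique up to a null set. Hence the data of the two
   problems agree for almost every frequency, where the linear ODE for [uhat]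
   has a unique solution, and injectivity brings the equality back to [u]. *)

(** The relation [is_fourierL2] fixes a transform only through L^2 limits, so no pointwise formula
    is available for it, and each solution brings its own representatives of the transforms of [g0]
    and of its source. Plancherel's theorem would settle both uniqueness and injectivity. It is
    avoided by looking at a transform only through its pairings with fixed square-integrable
    functions, which survive L^2 limits. The factor exp(-e|k|) has two jobs: it makes exp(-e|k|)
    exp(-ikx) such a test function, and it makes the double integrals absolutely convergent. Unlike
    a Gaussian it has a rational transform, and the integrals to be computed have elementary
    antiderivatives: an exponential times trigonometric functions in frequency, [atan] in space. All
    integrals are real: complex identities are split into real and imaginary parts, and
    multiplication by -i, which exchanges the parts, reduces imaginary parts to real ones. *)

(** * Fubini for an integrable product times a bounded kernel *)

Section BoundedKernel.
Context d1 d2 (T1 : measurableType d1) (T2 : measurableType d2) (R : realType).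
Variables (m1 : {sigma_finite_measure set T1 -> \bar R})
          (m2 : {sigma_finite_measure set T2 -> \bar R}).
Variables (f : T1 -> R) (g : T2 -> R) (K : T1 * T2 -> R) (C : R).
Hypotheses (hf : m1.-integrable setT (EFin \o f))
           (hg : m2.-integrable setT (EFin \o g)).
Hypotheses (C0 : 0 <= C) (mK : measurable_fun setT K).
Hypothesis KC : forall z, `|K z| <= C.

Let Phi (z : T1 * T2) := (f z.1 * g z.2 * K z)%:E.

(** Tonelli: the iterated integral of the absolute value is at most [C] times the product of the L^1
    norms of [f] and [g]. *)
Lemma bounded_kernel_integrable : (m1 \x m2)%E.-integrable setT Phi.
Proof.
have mf : measurable_fun setT f by apply/measurable_EFinP; exact: measurable_int hf.
have mg : measurable_fun setT g by apply/measurable_EFinP; exact: measurable_int hg.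
have mPhi : measurable_fun setT Phi.
  apply/measurable_EFinP; apply: measurable_funM => //.
  by apply: measurable_funM; exact: measurableT_comp.
apply/integrable12ltyP => //.
have [_ fi] := integrableP _ _ _ hf; have [_ gi] := integrableP _ _ _ hg.
apply: (@le_lt_trans _ _ (\int[m1]_x (`|(f x)%:E| * (C%:E * \int[m2]_y `|(g y)%:E|)))%E).
  apply: ge0_le_integral => //.
  - by move=> x _; apply: integral_ge0.
  - apply: (measurable_fun_fubini_tonelli_F (abse \o Phi)).
      exact: (measurableT_comp _ mPhi).
    by move=> z; exact: abse_ge0.
  - apply: emeasurable_funM => //.
    by apply: measurableT_comp => //; exact/measurable_EFinP.
  move=> x _.
  rewrite muleA -ge0_integralZl//; last 2 first.
    by apply: measurableT_comp => //; exact/measurable_EFinP.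
    by rewrite mule_ge0// lee_fin.
  apply: ge0_le_integral => //.
  - have mP := measurableT_comp mPhi (pair1_measurable x).
    exact: (measurableT_comp _ mP).
  - apply: emeasurable_funM => //.
    by apply: measurableT_comp => //; exact/measurable_EFinP.
  move=> y _; rewrite /Phi/= lee_fin !normrM mulrAC.
  by apply: ler_wpM2r => //; rewrite ler_wpM2l.
rewrite ge0_integralZr//; last 2 first.
  by apply: measurableT_comp => //; exact/measurable_EFinP.
  by rewrite mule_ge0 ?lee_fin ?integral_ge0.
apply: lte_mul_pinfty => //.
- exact: integral_ge0.
- by rewrite ge0_fin_numE// integral_ge0.
- by apply: lte_mul_pinfty.
Qed.

Let K1 x : m2.-integrable setT (EFin \o fun y => g y * K (x, y)).
Proof.
have mg : measurable_fun setT g by apply/measurable_EFinP; exact: measurable_int hg.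
apply: (@le_integrable _ _ _ m2 setT measurableT _ (fun y => (C * g y)%:E)); last first.
- by under eq_fun do rewrite EFinM; apply: integrableZl.
- move=> y _ /=; rewrite lee_fin !normrM mulrC ler_wpM2r//.
  by rewrite (le_trans (KC _))// ler_norm.
- apply/measurable_EFinP; apply: measurable_funM => //.
  by apply: measurableT_comp => //; exact: pair1_measurable.
Qed.

Let K2 y : m1.-integrable setT (EFin \o fun x => f x * K (x, y)).
Proof.
have mf : measurable_fun setT f by apply/measurable_EFinP; exact: measurable_int hf.
apply: (@le_integrable _ _ _ m1 setT measurableT _ (fun y => (C * f y)%:E)); last first.
- by under eq_fun do rewrite EFinM; apply: integrableZl.
- move=> x _ /=; rewrite lee_fin !normrM mulrC ler_wpM2r//.
  by rewrite (le_trans (KC _))// ler_norm.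
- apply/measurable_EFinP; apply: measurable_funM => //.
  by apply: measurableT_comp => //; exact: pair2_measurable.
Qed.

Let innerE x : (\int[m2]_y Phi (x, y))%E = (f x * \int[m2]_y (g y * K (x, y)))%:E.
Proof.
rewrite EFinM fineK; last exact: (integrable_fin_num measurableT (K1 x)).
by rewrite -(integralZl measurableT (K1 x)); apply: eq_integral => y _; rewrite /Phi/= -mulrA.
Qed.

Let outerE y : (\int[m1]_x Phi (x, y))%E = (g y * \int[m1]_x (f x * K (x, y)))%:E.
Proof.
rewrite EFinM fineK; last exact: (integrable_fin_num measurableT (K2 y)).
by rewrite -(integralZl measurableT (K2 y)); apply: eq_integral => x _; rewrite /Phi/= -mulrA mulrCA.
Qed.

Lemma bounded_kernel_integrable1 :
  m1.-integrable setT (EFin \o fun x => f x * \int[m2]_y (g y * K (x, y))).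
Proof.
have := integrable_fubini_F bounded_kernel_integrable.
by congr integrable; apply/funext => x; exact: innerE.
Qed.

Lemma bounded_kernel_fubini :
  \int[m1]_x (f x * \int[m2]_y (g y * K (x, y))) =
  \int[m2]_y (g y * \int[m1]_x (f x * K (x, y))).
Proof.
rewrite /Rintegral -/(Rintegral _ _ _); congr fine.
under eq_integral do rewrite -innerE.
rewrite (Fubini bounded_kernel_integrable).
by apply: eq_integral => y _; exact: outerE.
Qed.

End BoundedKernel.

(** * The Poisson kernel as the transform of exp(-e|k|) *)

Section PoissonKernel.
Context {R : realType}.
Local Notation mu := (@lebesgue_measure R).
Local Notation L1 f := (mu.-integrable setT (EFin \o f)).
Implicit Types (e a b k x y z : R).

(** Splitting at 0 avoids the kink of [damping]: on each half-line it is a plain exponential, so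
    explicit antiderivatives exist. *)
Lemma ge0_integralT_fold (f : R -> R) : (forall x, 0 <= f x) -> continuous f ->
  (\int[mu]_x (f x)%:E = \int[mu]_(x in `[(0 : R)%R, +oo[) (f x)%:E
                        + \int[mu]_(x in `[(0 : R)%R, +oo[) (f (- x))%:E)%E.
Proof.
move=> f0 cf.
have mf : measurable_fun [set: R] f by exact: continuous_measurable_fun.
rewrite -(setUv (`[(0 : R), +oo[%classic : set R)) ge0_integral_setU//=; last 4 first.
- exact: measurableC.
- by apply/measurable_EFinP; rewrite setUv.
- by move=> x _; rewrite lee_fin.
- exact/disj_setPCl.
congr (_ + _)%E.
rewrite setCitvr integral_itv_bndo_bndc; last exact/measurable_EFinP/measurable_funTS.
rewrite -{1}oppr0 ge0_integration_by_substitutionNy//.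
exact: continuous_subspaceT.
Qed.

Definition damping e k : R := expR (- (e * `|k|)).

(** For [e > 0], the Poisson kernel of the upper half-plane at height [e] without its normalising
    factor [1 / pi]; its total mass is thus [pi]. *)
Definition poisson e z : R := e / (e ^+ 2 + z ^+ 2).

Lemma continuous_damping e : continuous (damping e).
Proof.
move=> k; apply: continuous_comp; last exact: continuous_expR.
apply: continuousN; apply: cvgM; first exact: cvg_cst.
exact: norm_continuous.
Qed.

Lemma damping_gt0 e k : 0 < damping e k.
Proof. exact: expR_gt0. Qed.

Lemma damping_le1 e k : 0 < e -> damping e k <= 1.
Proof. by move=> e0; rewrite -expR0 ler_expR oppr_le0 mulr_ge0// ltW. Qed.

Lemma poisson_denom_gt0 e z : 0 < e -> 0 < e ^+ 2 + z ^+ 2.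
Proof. by move=> e0; rewrite ltr_wpDr ?sqr_ge0// exprn_gt0. Qed.

Lemma continuous_trig e a b z :
  continuous (fun k => 1 + a * cos (k * z) + b * sin (k * z)).
Proof.
move=> k; have ck : {for k, continuous (fun k => k * z)}.
  by apply: cvgM; [exact: cvg_id|exact: cvg_cst].
apply: cvgD; first apply: cvgD; first exact: cvg_cst.
- apply: cvgM; first exact: cvg_cst.
  by apply: continuous_comp ck _; exact: continuous_cos.
- apply: cvgM; first exact: cvg_cst.
  by apply: continuous_comp ck _; exact: continuous_sin.
Qed.

Lemma cvg_mul0_bounded (f g : R -> R) (C : R) (F : set_system R) : Filter F ->
  f @ F --> 0 -> (forall x, `|g x| <= C) -> (f \* g) @ F --> 0.
Proof.
move=> FF f0 gC; apply/norm_cvg0P.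
apply: (@squeeze_cvgr _ _ _ _ (cst 0) (fun x => `|f x| * C)).
- by apply: nearW => x /=; rewrite normr_ge0/= normrM ler_wpM2l.
- exact: cvg_cst.
- rewrite -[X in _ --> X](mul0r C); apply: cvgM; last exact: cvg_cst.
  exact/norm_cvg0P.
Qed.

(* The summand 1 makes the integrand nonnegative, as required by the improper
   fundamental theorem of calculus; it is subtracted again in [Rint_trig]. *)
Lemma integral_halfline_exp_trig e a b z : 0 < e ->
  (forall t, 0 <= 1 + a * cos t + b * sin t) ->
  (\int[mu]_(k in `[(0 : R)%R, +oo[)
     (damping e k * (1 + a * cos (k * z) + b * sin (k * z)))%:E =
   (e^-1 + (a * e + b * z) / (e ^+ 2 + z ^+ 2))%:E)%E.
Proof.
move=> e0 ab0.
have D0 := poisson_denom_gt0 z e0.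
(* An antiderivative of the form exp(-ek) N(k) requires N' - e N = 1 + a cos(kz) + b sin(kz).
   Comparing coefficients gives B z - e A = a and - A z - e B = b, which these [A] and [B] solve;
   the constant term of N is -1/e. *)
pose A := - (a * e + b * z) / (e ^+ 2 + z ^+ 2).
pose B := (a * z - b * e) / (e ^+ 2 + z ^+ 2).
pose N k := - e^-1 + A * cos (k * z) + B * sin (k * z).
pose F k := expR (- (e * k)) * N k.
pose f k := expR (- (e * k)) * (1 + a * cos (k * z) + b * sin (k * z)).
have sE (x y : R^o) : x *: y = x * y by [].
have dF k : is_derive k 1 F (f k).
  rewrite /f /F /N; apply: is_derive_eq.
  rewrite !sE /A /B; field.
  by rewrite !gt_eqF.
have cF : continuous F.
  by move=> k; apply/differentiable_continuous/derivable1_diffP; exact: ex_derive.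
have NC k : `|N k| <= e^-1 + `|A| + `|B|.
  rewrite /N (le_trans (ler_normD _ _))// lerD//; last first.
    by rewrite normrM ler_piMr// ler_norml sin_geN1 sin_le1.
  rewrite (le_trans (ler_normD _ _))// lerD//.
    by rewrite normrN gtr0_norm// invr_gt0.
  by rewrite normrM ler_piMr// ler_norml cos_geN1 cos_le1.
transitivity (\int[mu]_(k in `[(0 : R)%R, +oo[) (f k)%:E)%E.
  apply: eq_integral => k; rewrite inE/= in_itv/= andbT => k0.
  by rewrite /damping ger0_norm.
rewrite (@ge0_continuous_FTC2y _ f F 0 0).
- rewrite -EFinB /F /N !(mulr0, mul0r, oppr0, expR0, cos0, sin0) mul1r; congr EFin.
  by rewrite /A; field; rewrite !gt_eqF.
- by move=> x _; rewrite mulr_ge0// ?expR_ge0.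
- apply: continuous_subspaceT => k; apply: cvgM; last exact: continuous_trig.
  by apply: continuous_comp; [apply: cvgN; apply: cvgM; [exact: cvg_cst|exact: cvg_id]
                             |exact: continuous_expR].
- apply: (@cvg_mul0_bounded (fun k => expR (- (e * k))) N _ _ _ _ NC).
  apply: (@cvg_comp _ _ _ (fun k => e * k) (fun x => expR (- x)) _ (pinfty_nbhs R));
    last exact: cvgr_expR.
  by apply: gt0_cvgMry => //; exact: cvg_id.
- by move=> x _; exact: ex_derive.
- by apply: cvg_at_right_filter; exact: cF.
- by move=> x _; rewrite derive1E derive_val.
Qed.

(** Reflecting the negative half-line turns [b] into [- b], so the sine contributions of the two
    halves cancel and the others double. *)
Lemma integral_damping_trig e a b z : 0 < e ->
  (forall t, 0 <= 1 + a * cos t + b * sin t) ->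
  (\int[mu]_k (damping e k * (1 + a * cos (k * z) + b * sin (k * z)))%:E =
   (2 / e + a * (2 * poisson e z))%:E)%E.
Proof.
move=> e0 ab0; have D0 := poisson_denom_gt0 z e0.
rewrite ge0_integralT_fold; last 2 first.
- by move=> k; rewrite mulr_ge0// ltW// damping_gt0.
- by move=> k; apply: cvgM; [exact: continuous_damping|exact: continuous_trig].
rewrite integral_halfline_exp_trig//.
under eq_integral => k _.
  rewrite {1}/damping normrN -/(damping e k) mulNr cosN sinN mulrN -mulNr.
  over.
rewrite integral_halfline_exp_trig//; last first.
  by move=> t; have := ab0 (- t); rewrite cosN sinN mulrN mulNr.
rewrite -EFinD /poisson; congr EFin; field.
by rewrite !gt_eqF.
Qed.

Lemma integrable_damping_trig e a b z : 0 < e ->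
  (forall t, 0 <= 1 + a * cos t + b * sin t) ->
  L1 (fun k => damping e k * (1 + a * cos (k * z) + b * sin (k * z))).
Proof.
move=> e0 ab0; apply/integrableP; split.
  apply/measurable_EFinP; apply: continuous_measurable_fun => k.
  by apply: cvgM; [exact: continuous_damping|exact: continuous_trig].
under eq_integral => k _.
  rewrite /= ger0_norm; last by rewrite mulr_ge0// ltW// damping_gt0.
  over.
by rewrite integral_damping_trig// ltry.
Qed.

Lemma integrable_damping e : 0 < e -> L1 (damping e).
Proof.
move=> e0.
have -> : damping e =
    fun k => damping e k * (1 + 0 * cos (k * 0) + 0 * sin (k * 0)).
  by apply/funext => k; rewrite !mul0r !addr0 mulr1.
by apply: integrable_damping_trig => // t; rewrite !mul0r !addr0.
Qed.

Let Rint_trig e a b z : 0 < e ->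
  (forall t, 0 <= 1 + a * cos t + b * sin t) ->
  \int[mu]_k (damping e k * (a * cos (k * z) + b * sin (k * z))) =
   a * (2 * poisson e z).
Proof.
move=> e0 ab0.
have i0 : (forall t : R, 0 <= 1 + 0 * cos t + 0 * sin t).
  by move=> t; rewrite !mul0r !addr0.
transitivity (\int[mu]_k (damping e k * (1 + a * cos (k * z) + b * sin (k * z)) -
  damping e k * (1 + 0 * cos (k * z) + 0 * sin (k * z)))).
  by apply: eq_Rintegral => k _; ring.
rewrite RintegralB//; try exact: integrable_damping_trig.
by rewrite /Rintegral !integral_damping_trig//=; ring.
Qed.

Lemma integral_damping_cos e z : 0 < e ->
  \int[mu]_k (damping e k * cos (k * z)) = 2 * poisson e z.
Proof.
move=> e0; rewrite -[RHS]mul1r -(@Rint_trig e 1 0 z e0).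
  by apply: eq_Rintegral => k _; ring.
by move=> t; rewrite mul0r addr0 mul1r -lerBlDl sub0r cos_geN1.
Qed.

Lemma integral_damping_sin e z : 0 < e ->
  \int[mu]_k (damping e k * sin (k * z)) = 0.
Proof.
move=> e0; rewrite -[RHS](mul0r (2 * poisson e z)) -(@Rint_trig e 0 1 z e0).
  by apply: eq_Rintegral => k _; ring.
by move=> t; rewrite mul0r addr0 mul1r -lerBlDl sub0r sin_geN1.
Qed.

End PoissonKernel.

(** * Square-integrable functions, their pairings, and bounds on the Poisson kernel *)

Section SquareIntegrable.
Context {R : realType}.
Local Notation mu := (@lebesgue_measure R).
Local Notation L1 f := (mu.-integrable setT (EFin \o f)).
Implicit Types (e a b c k x y z : R) (f w K : R -> R).

Lemma Lfun_measurable p f : f \in Lfun mu p -> measurable_fun setT f.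
Proof. by case/andP; rewrite inE. Qed.

Lemma Lfun2B f w : f \in Lfun mu 2%:E -> w \in Lfun mu 2%:E ->
  (fun x => f x - w x) \in Lfun mu 2%:E.
Proof.
move=> fL wL; have [_ addL] := Lfun_addr_closed mu (lee1n 2).
exact: (addL _ _ fL (Lfun_oppr_closed wL)).
Qed.

Lemma integrable_sqr_Lfun2 f : measurable_fun setT f ->
  L1 (fun x => f x ^+ 2) -> f \in Lfun mu 2%:E.
Proof.
move=> mf /integrableP[_ fi]; apply/andP; rewrite !inE/=; split => //.
rewrite /finite_norm unlock; apply: poweR_lty; apply: le_lt_trans fi.
rewrite le_eqVlt; apply/orP; left; apply/eqP; apply: eq_integral => x _.
by rewrite [LHS]/= powR_mulrn// -normrX.
Qed.

(** The reciprocal of 1 + y^2 is the majorant used for Poisson kernels and their masses: it has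
    their decay and is both integrable and square-integrable. *)
Lemma integrable_oneDsqrV : L1 (fun y => (oneDsqr y)^-1).
Proof.
have p0 y : 0 <= (oneDsqr y)^-1 :> R by rewrite invr_ge0 (le_trans ler01).
apply/integrableP; split.
  by apply/measurable_EFinP; apply: continuous_measurable_fun; exact: continuous_oneDsqrV.
under eq_integral do rewrite /= ger0_norm//.
rewrite ge0_symfun_integralT//; last 2 first.
- exact: continuous_oneDsqrV.
- by move=> y /=; rewrite /oneDsqr sqrrN.
rewrite -set_itvcy integral0y_oneDsqr.
by rewrite -EFinM ltry.
Qed.

Lemma oneDsqrV_Lfun2 : (fun y => (oneDsqr y)^-1) \in Lfun mu 2%:E.
Proof.
have mV : measurable_fun setT (fun y : R => (oneDsqr y)^-1).
  by apply: continuous_measurable_fun; exact: continuous_oneDsqrV.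
apply: integrable_sqr_Lfun2 => //.
apply: (le_integrable measurableT _ _ integrable_oneDsqrV).
  by apply/measurable_EFinP; exact: measurable_funX.
move=> y _ /=; rewrite lee_fin normrX expr2.
rewrite ler_piMl// ger0_norm ?invr_ge0 ?(le_trans ler01)//.
by rewrite invf_le1// (lt_le_trans ltr01).
Qed.

Lemma Lfun2_dominated f C : measurable_fun setT f ->
  (forall y, `|f y| <= C / oneDsqr y) -> f \in Lfun mu 2%:E.
Proof.
move=> mf fC; apply: integrable_sqr_Lfun2 => //.
have := Lfun2_integrable_sqr (Lfun_scale C (ler1n R 2) oneDsqrV_Lfun2).
apply: le_integrable => //.
  by apply/measurable_EFinP; exact: measurable_funX.
move=> y _ /=; rewrite lee_fin !normrX lerXn2r ?nnegrE//.
by rewrite mulrC (le_trans (fC y))// ler_norm.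
Qed.

Lemma poisson_ge0 e z : 0 < e -> 0 <= poisson e z.
Proof. by move=> e0; rewrite divr_ge0// ltW// poisson_denom_gt0. Qed.

Lemma continuous_poisson e : 0 < e -> continuous (poisson e).
Proof.
move=> e0 z; apply: cvgM; first exact: cvg_cst.
apply: cvgV; first by rewrite gt_eqF// poisson_denom_gt0.
by apply: cvgD; [exact: cvg_cst|exact: exprn_continuous].
Qed.

(** By y = x + (y - x), 1 + y^2 is at most (1 + 2c^2) + 2(y - x)^2, and both terms are controlled by
    e^2 + (y - x)^2, the first at the price of 1/e^2. The constant blows up as [e] tends to 0, so
    the bound serves for fixed [e] only. *)
Lemma poisson_le e c x y : 0 < e -> `|x| <= c ->
  poisson e (y - x) <= e * ((1 + 2 * c ^+ 2) / e ^+ 2 + 2) / oneDsqr y.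
Proof.
move=> e0 xc; have D0 := poisson_denom_gt0 (y - x) e0.
have E0 : 0 < oneDsqr y by rewrite (lt_le_trans ltr01).
have xc2 : x ^+ 2 <= c ^+ 2.
  by rewrite -(real_normK (num_real x)) lerXn2r ?nnegrE// (le_trans _ xc).
rewrite /poisson -mulrA ler_wpM2l ?(ltW e0)// ler_pdivlMr// mulrC ler_pdivrMr//.
have H : 0 <= (y - x) ^+ 2 * (1 + 2 * c ^+ 2) / e ^+ 2.
  by rewrite divr_ge0 ?sqr_ge0// mulr_ge0 ?sqr_ge0// addr_ge0// mulr_ge0 ?sqr_ge0.
have -> : ((1 + 2 * c ^+ 2) / e ^+ 2 + 2) * (e ^+ 2 + (y - x) ^+ 2) =
   1 + 2 * c ^+ 2 + (y - x) ^+ 2 * (1 + 2 * c ^+ 2) / e ^+ 2 + 2 * e ^+ 2 + 2 * (y - x) ^+ 2.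
  by field; rewrite gt_eqF.
(* (y - 2x)^2 >= 0 says exactly that y^2 <= 2x^2 + 2(y - x)^2. *)
have := sqr_ge0 (y - x - x); have := sqr_ge0 e.
rewrite /oneDsqr; move: H; set h := (_ / e ^+ 2); lra.
Qed.

(** Here the constant does not depend on [e], as dominated convergence will require. The threshold
    2c + 1 makes |y - x| >= |y| - c > (|y| + 1)/2, whence 4(y - x)^2 >= 1 + y^2. *)
Lemma poisson_le_far e c x y : 0 < e <= 1 -> `|x| <= c -> 2 * c + 1 < `|y| ->
  poisson e (y - x) <= 4 / oneDsqr y.
Proof.
move=> /andP[e0 e1] xc yc; have D0 := poisson_denom_gt0 (y - x) e0.
have E0 : 0 < oneDsqr y by rewrite (lt_le_trans ltr01).
rewrite /poisson ler_pdivrMr// mulrAC ler_pdivlMr//.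
have h : `|y| - c <= `|y - x|.
  by apply: le_trans (lerB_dist _ _); rewrite lerD2l lerN2.
have -> : (y - x) ^+ 2 = `|y - x| ^+ 2 by rewrite real_normK// num_real.
have -> : oneDsqr y = 1 + `|y| ^+ 2 by rewrite real_normK// num_real.
have x0 := normr_ge0 x; have y0 := normr_ge0 y; have z0 := normr_ge0 (y - x).
move: h xc yc x0 y0 z0; set X := `|x|; set Y := `|y|; set Z := `|y - x|.
move=> h xc yc x0 y0 z0.
have : 1 + Y ^+ 2 <= 4 * Z ^+ 2 by nra.
move=> H; have := sqr_ge0 e; nra.
Qed.

Lemma poisson_Lfun2 e x : 0 < e -> (fun y => poisson e (y - x)) \in Lfun mu 2%:E.
Proof.
move=> e0.
apply: (@Lfun2_dominated _ (e * ((1 + 2 * `|x| ^+ 2) / e ^+ 2 + 2))).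
  apply: continuous_measurable_fun => y.
  apply: (@continuous_comp _ _ _ (fun y => y - x) (poisson e)).
    by apply: cvgB; [exact: cvg_id|exact: cvg_cst].
  exact: continuous_poisson.
by move=> y; rewrite ger0_norm ?poisson_ge0//; exact: poisson_le.
Qed.

Lemma Lfun2_mul_integrable f w : f \in Lfun mu 2%:E -> w \in Lfun mu 2%:E ->
  L1 (fun y => f y * w y).
Proof. by move=> hf hw; apply/Lfun1_integrable; exact: Lfun2_mul_Lfun1. Qed.

(** Cauchy-Schwarz applied to [f_ n - f] and the fixed [K]. Only integrability of [f_ n * K] is
    asked of the approximants, because they will also be transforms of L^1 functions, whose
    square-integrability is not established. *)
Lemma Lfun2_pairing_cvg (f_ : nat -> R -> R) f K :
  (forall n, measurable_fun setT (f_ n)) -> (forall n, L1 (fun x => f_ n x * K x)) ->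
  f \in Lfun mu 2%:E -> K \in Lfun mu 2%:E ->
  'N[mu]_2%:E[EFin \o (fun x => f_ n x - f x)%R]%E @[n --> \oo] --> 0%E ->
  \int[mu]_x (f_ n x * K x) @[n --> \oo] --> \int[mu]_x (f x * K x).
Proof.
move=> mf_ f_K fL KL f_f.
have fK : L1 (fun x => f x * K x) by exact: Lfun2_mul_integrable.
have iL n : L1 (fun x => (f_ n x - f x) * K x).
  have := integrableB measurableT (f_K n) fK.
  by congr integrable; apply/funext => x /=; rewrite mulrBl EFinB.
have H n : (`|(\int[mu]_x (f_ n x * K x) - \int[mu]_x (f x * K x))%:E| <=
   'N[mu]_2%:E[EFin \o (fun x => f_ n x - f x)%R] * 'N[mu]_2%:E[EFin \o K])%E.
  rewrite -RintegralB//.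
  under eq_Rintegral do rewrite -mulrBl.
  apply: le_trans (@hoelder _ _ R mu (fun x => f_ n x - f x) K 2 2 _ _ _ _ _) => //.
  - rewrite Lnorm1 /Rintegral fineK; last exact: (integrable_fin_num measurableT (iL n)).
    apply: le_abse_integral => //.
    by apply: measurable_int (iL n).
  - exact: measurable_funB (mf_ n) (Lfun_measurable fL).
  - exact: Lfun_measurable KL.
  - by rewrite [RHS]splitr !div1r.
have Kfin : 'N[mu]_2%:E[EFin \o K]%E \is a fin_num.
  rewrite ge0_fin_numE ?Lnorm_ge0//.
  by move: KL => /andP[_]; rewrite inE.
apply/subr_cvg0/norm_cvg0P.
apply: (@fine_cvg _ _ _ _ (fun n => `|(\int[mu]_x (f_ n x * K x) -
  \int[mu]_x (f x * K x))%:E|%E)).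
apply: (@squeeze_cvge _ _ _ _ (cst 0%E) _
  (fun n => ('N[mu]_2%:E[EFin \o (fun x => f_ n x - f x)%R] *
             'N[mu]_2%:E[EFin \o K])%E)).
- by apply: nearW => n; apply/andP; split; [exact: abse_ge0|exact: H].
- exact: cvg_cst.
- by have := cvgeZr Kfin f_f; rewrite mul0e.
Qed.

(** Pairing [w] with [\1_D], which is square-integrable since [D] has finite measure. *)
Lemma Lfun2_integrable_finite w D : measurable D -> (mu D < +oo)%E ->
  w \in Lfun mu 2%:E -> mu.-integrable D (EFin \o w).
Proof.
move=> mD Dfin wL.
have iD : L1 (\1_D : R -> R).
  apply/integrableP; split; first exact/measurable_EFinP.
  under eq_integral do rewrite /= ger0_norm//.
  by rewrite integral_indic// setIT.
have DL : (\1_D : R -> R) \in Lfun mu 2%:E.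
  apply: integrable_sqr_Lfun2 => //; move: iD; congr integrable.
  by apply/funext => x /=; rewrite indicE; case: (x \in D); rewrite ?expr1n ?expr0n.
have := Lfun2_mul_integrable wL DL.
rewrite (integrable_mkcond _ mD); congr integrable.
by apply/funext => x /=; rewrite patchE indicE; case: (x \in D); rewrite ?mulr1 ?mulr0.
Qed.

Lemma Lfun2_locally_integrable w : w \in Lfun mu 2%:E -> locally_integrable setT w.
Proof.
move=> wL; split; [exact: Lfun_measurable wL|exact: openT|move=> K _ cK].
have /integrableP[_] := Lfun2_integrable_finite (compact_measurable cK)
  (compact_finite_measure cK) wL.
by [].
Qed.

End SquareIntegrable.

(** * Vanishing Poisson integrals force the function to vanish *)

Section PoissonInjectivity.
Context {R : realType}.
Local Notation mu := (@lebesgue_measure R).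
Local Notation L1 f := (mu.-integrable setT (EFin \o f)).
Implicit Types (e a b c k x y z : R) (w : R -> R).

(** Lebesgue differentiation: the primitive of [w] starting at -n is identically 0, and its
    derivative is [w] almost everywhere to the right of -n. Countably many starting points exhaust
    the line. *)
Lemma ae_eq0_of_integral_itv w : locally_integrable setT w ->
  (forall a b, mu.-integrable `[a, b] (EFin \o w)) ->
  (forall a b, a < b -> \int[mu]_(x in `[a, b]) w x = 0) ->
  {ae mu, forall x, w x = 0}.
Proof.
move=> wloc wint w0.
have : {ae mu, forall x, forall n : nat, - n%:R < x -> w x = 0}.
  apply: ae_foralln => n.
  have := FTC1 (a := BLeft (- n%:R)) (wint _) wloc.
  apply: filterS; first exact: (ae_filter_ringOfSetsType mu).
  move=> x /= H nx; have [|_ <-] := H _; first by rewrite lte_fin.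
  rewrite (_ : (fun _ => _) = cst 0) ?derive1_cst//; apply/funext => y /=.
  have [ny|ny|->] := ltgtP (- n%:R) y; first exact: w0.
  - by rewrite set_itv_ge ?Rintegral_set0// bnd_simp -ltNge.
  - by rewrite set_itv1 Rintegral_set1.
apply: filterS; first exact: (ae_filter_ringOfSetsType mu).
move=> x /(_ (Num.truncn `|x|).+1); apply.
rewrite ltrNl (le_lt_trans _ (truncnS_gt _))//.
by rewrite -normrN ler_norm.
Qed.

Lemma is_derive_atan_scaled e y x : 0 < e ->
  is_derive x 1 (fun x => atan ((x - y) / e)) (poisson e (y - x)).
Proof.
move=> e0.
have dlin : is_derive x 1 (fun x : R => (x - y) / e) (e^-1).
  by apply: is_derive_eq; rewrite scaler0 add0r subr0 [LHS]mulr1.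
have := @is_derive1_comp _ atan (fun x : R => (x - y) / e) x _ _ (is_derive1_atan _) dlin.
move/is_derive_eq; apply; have D0 := poisson_denom_gt0 (y - x) e0.
rewrite /poisson expr_div_n -sqrrN opprB [LHS]/=; field.
by rewrite !gt_eqF.
Qed.

Lemma continuous_atan_scaled e y : 0 < e -> continuous (fun x => atan ((x - y) / e)).
Proof.
move=> e0 x; apply/differentiable_continuous/derivable1_diffP.
by have [] := is_derive_atan_scaled y x e0.
Qed.

(** For [0 < e] and [a < b], the angle under which [[a, b]] is seen from the point at height [e]
    above [y]. *)
Definition poisson_mass e a b y := atan ((b - y) / e) - atan ((a - y) / e).

Lemma integral_poisson_itv e a b y : 0 < e -> a < b ->
  \int[mu]_(x in `[a, b]) poisson e (y - x) = poisson_mass e a b y.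
Proof.
move=> e0 ab; rewrite /Rintegral.
rewrite (@continuous_FTC2 _ _ (fun x => atan ((x - y) / e))) //.
- apply: continuous_subspaceT => x.
  apply: (@continuous_comp _ _ _ (fun x => y - x) (poisson e)).
    by apply: cvgB; [exact: cvg_cst|exact: cvg_id].
  exact: continuous_poisson.
- split=> [x _| |].
  + by have [] := is_derive_atan_scaled y x e0.
  + by apply: cvg_at_right_filter; exact: continuous_atan_scaled.
  + by apply: cvg_at_left_filter; exact: continuous_atan_scaled.
- move=> x _; rewrite derive1E; have [_ ->] // := is_derive_atan_scaled y x e0.
Qed.

(** A bound uniform in [e]. For |y| <= 2c + 1 a difference of two arctangents is at most [pi].
    Beyond, the mean value theorem turns the mass into [b - a] times a value of the kernel, to which
    [poisson_le_far] applies. The constant adds up the two cases. *)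
Lemma poisson_mass_le e a b c y : 0 < e <= 1 -> a < b -> `|a| <= c -> `|b| <= c ->
  `|poisson_mass e a b y| <=
    (pi * oneDsqr (2 * c + 1) + 4 * (b - a)) / oneDsqr y.
Proof.
move=> e01 ab ac bc; have /andP[e0 e1] := e01.
have E0 : 0 < oneDsqr y by rewrite (lt_le_trans ltr01).
have E1 : 0 < oneDsqr (2 * c + 1) by rewrite (lt_le_trans ltr01).
have c0 : 0 <= c by apply: le_trans ac.
have p0 := pi_ge0 R.
have [yc|yc] := leP `|y| (2 * c + 1).
- rewrite ler_pdivlMr//.
  apply: (@le_trans _ _ (pi * oneDsqr y)).
    rewrite ler_wpM2r ?(ltW E0)// /poisson_mass.
    rewrite ler_norml.
    have := atan_gtNpi2 ((b - y) / e); have := atan_gtNpi2 ((a - y) / e).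
    have := atan_ltpi2 ((b - y) / e); have := atan_ltpi2 ((a - y) / e).
    lra.
  apply: (@le_trans _ _ (pi * oneDsqr (2 * c + 1))); last by rewrite lerDl mulr_ge0// subr_ge0 ltW.
  rewrite ler_wpM2l// /oneDsqr lerD2l -(real_normK (num_real y)).
  by rewrite lerXn2r ?nnegrE// addr_ge0// mulr_ge0.
- have [x] := MVT ab (fun x _ => is_derive_atan_scaled y x e0)
    (continuous_subspaceT (@continuous_atan_scaled e y e0)).
  rewrite in_itv/= => /andP[ax xb]; rewrite /poisson_mass => ->.
  rewrite normrM ger0_norm ?poisson_ge0// gtr0_norm ?subr_gt0//.
  have xc : `|x| <= c.
    by move: ac bc; rewrite !ler_norml; lra.
  have := poisson_le_far e01 xc yc => H.
  rewrite mulrDl (le_trans (ler_wpM2r _ H)) ?subr_ge0 ?(ltW ab)//.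
  rewrite mulrAC lerDr divr_ge0 ?(ltW E0)// mulr_ge0 ?(ltW E1)//.
Qed.

Lemma atan_scaled_cvg (t : R) :
  atan (t / (n.+1%:R)^-1) @[n --> \oo] --> Num.sg t * (pi / 2).
Proof.
have pos (s : R) : 0 < s -> atan (s / (n.+1%:R)^-1) @[n --> \oo] --> pi / 2.
  move=> s0; apply: (@cvg_comp _ _ _ (fun n => s / (n.+1%:R)^-1) atan _ (pinfty_nbhs R));
    last exact: cvgy_atan.
  have -> : (fun n : nat => s / n.+1%:R^-1) = (fun n : nat => s * n.+1%:R).
    by apply/funext => n; rewrite invrK.
  apply: (@cvg_comp _ _ _ (fun n : nat => n.+1%:R : R) (fun x => s * x) _ (pinfty_nbhs R));
    last by apply: gt0_cvgMry => //; exact: cvg_id.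
  by rewrite (cvg_shiftS (fun n => n%:R : R)); exact: cvgr_idn.
case: (ltgtP t 0) => [t0|t0|->].
- rewrite ltr0_sg// mulN1r.
  have -> : (fun n : nat => atan (t / n.+1%:R^-1)) =
      (fun n : nat => - atan (- t / n.+1%:R^-1)).
    by apply/funext => n; rewrite mulNr atanN opprK.
  by apply: cvgN; apply: pos; rewrite oppr_gt0.
- by rewrite gtr0_sg// mul1r; exact: pos.
- under eq_fun do rewrite mul0r atan0.
  by rewrite sgr0 mul0r; exact: cvg_cst.
Qed.

(* Fubini over [x \in `[a, b]]; the factor [oneDsqr y] moved from the function
   to the kernel makes the former integrable and keeps the latter bounded. *)
Lemma poisson_mass_pairing w e a b : w \in Lfun mu 2%:E -> 0 < e -> a < b ->
  (forall x, \int[mu]_y (w y * poisson e (y - x)) = 0) ->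
  \int[mu]_y (w y * poisson_mass e a b y) = 0.
Proof.
move=> wL e0 ab w0.
have E0 y : 0 < oneDsqr y by rewrite (lt_le_trans ltr01).
pose I : R -> R := \1_(`[a, b]).
pose g y := w y * (oneDsqr y)^-1.
(* The indicator is repeated inside the kernel because the bound by [C] must hold on the whole
   plane, whereas [poisson_le] covers only |x| <= c; as [I] is idempotent, the integrals do not
   change. *)
pose K (p : R * R) := I p.1 * (oneDsqr p.2 * poisson e (p.2 - p.1)).
pose c := `|a| + `|b|.
pose C := e * ((1 + 2 * c ^+ 2) / e ^+ 2 + 2).
have iI : L1 I by exact: integrable_indic_itv.
have ig : L1 g by exact: Lfun2_mul_integrable (oneDsqrV_Lfun2).
have mI : measurable_fun setT I by exact: measurable_indic.
have mK : measurable_fun setT K.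
  apply: measurable_funM.
    exact: (measurableT_comp mI measurable_fst).
  apply: measurable_funM.
    have mD : measurable_fun setT (@oneDsqr R).
      by apply: continuous_measurable_fun; exact: continuous_oneDsqr.
    exact: (measurableT_comp mD measurable_snd).
  have mP : measurable_fun setT (poisson e).
    by apply: continuous_measurable_fun; exact: continuous_poisson.
  exact: (measurableT_comp mP (measurable_funB measurable_snd measurable_fst)).
have C0 : 0 <= C.
  by rewrite mulr_ge0 ?(ltW e0)// addr_ge0// divr_ge0 ?sqr_ge0// addr_ge0// mulr_ge0 ?sqr_ge0.
have KC p : `|K p| <= C.
  rewrite /K /I indicE; case: (boolP (p.1 \in `[a, b]%classic)) => [|_];
    last by rewrite mul0r normr0.
  rewrite inE/= in_itv/= mul1r => /andP[ap pb].
  rewrite ger0_norm; last by apply: mulr_ge0; [exact: ltW (E0 _)|exact: poisson_ge0].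
  rewrite mulrC -ler_pdivlMr//; apply: poisson_le => //.
  have := ler_norm (- a); have := ler_norm b.
  rewrite normrN /c ler_norml; have := normr_ge0 a; have := normr_ge0 b.
  by move=> *; apply/andP; split; lra.
have Iw x : I x * \int[mu]_y (g y * K (x, y)) = 0.
  rewrite /K /I indicE/=; case: (x \in `[a, b]%classic); last by rewrite mul0r.
  rewrite mul1r -[RHS](w0 x); apply: eq_Rintegral => y _.
  by rewrite /g mul1r -mulrA mulKf// gt_eqF.
have gmass y : g y * \int[mu]_x (I x * K (x, y)) = w y * poisson_mass e a b y.
  have -> : \int[mu]_x (I x * K (x, y)) =
      \int[mu]_(x in `[a, b]) (oneDsqr y * poisson e (y - x)).
    rewrite [RHS]Rintegral_mkcond; apply: eq_Rintegral => x _.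
    rewrite patchE /K /I indicE/=; case: (x \in `[a, b]%classic); last by rewrite !mul0r.
    by rewrite !mul1r.
  rewrite RintegralZl//; last first.
    apply: continuous_compact_integrable; first exact: segment_compact.
    apply: continuous_subspaceT => x.
    apply: (@continuous_comp _ _ _ (fun x => y - x) (poisson e)).
      by apply: cvgB; [exact: cvg_cst|exact: cvg_id].
    exact: continuous_poisson.
  by rewrite integral_poisson_itv// /g -mulrA mulKf// gt_eqF.
have := bounded_kernel_fubini iI ig C0 mK KC.
under eq_Rintegral do rewrite Iw.
under [in X in _ = X]eq_Rintegral do rewrite gmass.
by move=> <-; rewrite Rintegral_cst// mul0r.
Qed.

(* As [e] tends to 0 the Poisson mass of [`[a, b]] tends to [pi] times the
   indicator of [`[a, b]], except at the endpoints. *)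
Lemma ae_eq0_of_poisson w : w \in Lfun mu 2%:E ->
  (forall e x, 0 < e -> \int[mu]_y (w y * poisson e (y - x)) = 0) ->
  {ae mu, forall x, w x = 0}.
Proof.
move=> wL w0.
have mw := Lfun_measurable wL.
have wfin a b : mu.-integrable `[a, b] (EFin \o w).
  apply: Lfun2_integrable_finite => //.
  by apply: compact_finite_measure; exact: segment_compact.
apply: ae_eq0_of_integral_itv => //; first exact: Lfun2_locally_integrable.
move=> a b ab.
(* The shift by one keeps every [e_ n] in the range [0 < e <= 1] where [poisson_mass_le] is
   uniform. *)
pose e_ (n : nat) : R := n.+1%:R^-1.
have e_01 n : 0 < e_ n <= 1.
  by rewrite /e_ invr_gt0 ltr0n/= invf_le1// ler1n.
pose c := `|a| + `|b|.
pose C := pi * oneDsqr (2 * c + 1) + 4 * (b - a).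
pose f_ (n : nat) y := (w y * poisson_mass (e_ n) a b y)%:E.
pose f y := (w y * (pi * \1_(`[a, b]) y))%:E.
(* The dominating function is integrable as a product of two square-integrable ones. *)
pose g y := (C * (`|w y| * (oneDsqr y)^-1))%:E.
have mmass n : measurable_fun setT (poisson_mass (e_ n) a b).
  have /andP[en0 _] := e_01 n.
  have cat x : continuous (fun y => atan ((x - y) / e_ n)).
    have -> : (fun y => atan ((x - y) / e_ n)) =
              (fun y => - atan ((y - x) / e_ n)).
      by apply/funext => y; rewrite -atanN -mulNr opprB.
    by move=> y; apply: cvgN; exact: continuous_atan_scaled.
  by apply: continuous_measurable_fun => y; apply: cvgB; exact: cat.
have mf_ n : measurable_fun setT (f_ n).
  by apply/measurable_EFinP; apply: measurable_funM.
have mf : measurable_fun setT f.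
  by apply/measurable_EFinP; apply: measurable_funM => //; apply: measurable_funM.
have f_f : {ae mu, forall y, setT y -> f_ ^~ y @ \oo --> f y}.
  have : mu.-negligible [set a; b].
    exists [set a; b]; split => //; first exact: measurableU.
    by apply: countable_lebesgue_measure0; exact: finite_set_countable.
  apply: negligibleS => y /=; apply: contra_notP => /not_orP[/eqP ya /eqP yb] _.
  apply: cvg_EFin; first exact: nearW.
  apply: cvgM; first exact: cvg_cst.
  rewrite (_ : pi * _ = Num.sg (b - y) * (pi / 2) - Num.sg (a - y) * (pi / 2)).
    by apply: cvgB; exact: atan_scaled_cvg.
  rewrite indicE /=.
  have [ya'|ya'|E] := ltgtP a y; last by rewrite E eqxx in ya.
    have [yb'|yb'|E] := ltgtP y b; last by rewrite E eqxx in yb.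
      rewrite mem_set/= ?in_itv/= ?(ltW ya') ?(ltW yb')//.
      by rewrite gtr0_sg ?subr_gt0// ltr0_sg ?subr_lt0//; field.
    rewrite memNset/= ?in_itv/= ?(ltW ya') -?ltNge//; last by rewrite leNgt yb'.
    by rewrite !ltr0_sg ?subr_lt0//; ring.
  rewrite memNset/= ?in_itv/=; last by rewrite leNgt ya'.
  by rewrite !gtr0_sg ?subr_gt0// ?(lt_trans ya')//; ring.
have ig : mu.-integrable setT g.
  rewrite /g; under eq_fun do rewrite EFinM; apply: integrableZl => //.
  apply: (@le_integrable _ _ _ mu setT measurableT _ (fun y => (w y * (oneDsqr y)^-1)%:E)).
  - apply/measurable_EFinP; apply: measurable_funM; first exact: measurableT_comp.
    by apply: continuous_measurable_fun; exact: continuous_oneDsqrV.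
  - by move=> y _ /=; rewrite lee_fin !normrM normr_id.
  - exact: Lfun2_mul_integrable (oneDsqrV_Lfun2).
have f_g : {ae mu, forall y n, setT y -> (`|f_ n y| <= g y)%E}.
  apply: aeW => y n _; rewrite /f_ /g/= lee_fin normrM mulrCA.
  rewrite ler_wpM2l//; apply: poisson_mass_le => //.
    by rewrite /c lerDl.
  by rewrite /c lerDr.
have [_ _ lim_f] := @dominated_convergence _ _ _ mu setT measurableT _ _ _ mf_ mf f_f ig f_g.
have int_n n : (\int[mu]_y f_ n y = 0)%E.
  have /andP[en0 _] := e_01 n.
  have iL : mu.-integrable setT (f_ n).
    apply: Lfun2_mul_integrable => //; apply: (@Lfun2_dominated _ _ C) => // y.
    apply: poisson_mass_le => //.
      by rewrite /c lerDl.
    by rewrite /c lerDr.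
  rewrite -(fineK (integrable_fin_num measurableT iL)).
  by congr EFin; apply: poisson_mass_pairing => // x; exact: w0.
have int0 : (\int[mu]_y f y = 0)%E.
  apply/esym; move: lim_f; under eq_fun do rewrite int_n.
  by move=> /cvg_lim <- //; rewrite lim_cst.
have iw : L1 (w \_ `[a, b]).
  have := wfin a b.
  rewrite (@integrable_mkcond _ _ _ mu _ (EFin \o w) (measurable_itv `[a, b])).
  by rewrite restrict_EFin.
have fE : f = fun y => (pi%:E * ((w \_ `[a, b]) y)%:E)%E.
  apply/funext => y; rewrite /f patchE indicE.
  by case: (y \in `[a, b]%classic); rewrite ?mulr1 ?mulr0 ?mule0// mulrC.
move: int0; rewrite fE integralZl// => /eqP.
rewrite mule_eq0 eqe gt_eqF ?pi_gt0//= => /eqP int0.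
by rewrite Rintegral_mkcond /Rintegral int0.
Qed.

End PoissonInjectivity.

(** * Damped inversion for integrable functions *)

Section FourierPairing.
Context {R : realType}.
Local Notation mu := (@lebesgue_measure R).
Local Notation L1 f := (mu.-integrable setT (EFin \o f)).
Local Notation Re := (@complex.Re R).
Local Notation Im := (@complex.Im R).
Implicit Types (e k x y : R) (p q b : R -> R).

Lemma integrable_mul_bounded p b : L1 p -> measurable_fun setT b ->
  (forall y, `|b y| <= 1) -> L1 (fun y => p y * b y).
Proof.
move=> ip mb b1.
have mp : measurable_fun setT p by apply/measurable_EFinP; exact: measurable_int ip.
apply: (le_integrable measurableT _ _ ip).
  by apply/measurable_EFinP; exact: measurable_funM.
by move=> y _ /=; rewrite lee_fin normrM ler_piMr.
Qed.

Lemma norm_cos_le1 x : `|cos x| <= 1.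
Proof. by rewrite ler_norml cos_geN1 cos_le1. Qed.

Lemma norm_sin_le1 x : `|sin x| <= 1.
Proof. by rewrite ler_norml sin_geN1 sin_le1. Qed.

Lemma measurable_cos : measurable_fun setT (@cos R).
Proof. by apply: continuous_measurable_fun; exact: continuous_cos. Qed.

Lemma measurable_sin : measurable_fun setT (@sin R).
Proof. by apply: continuous_measurable_fun; exact: continuous_sin. Qed.

Lemma integrable_scale k p : L1 p -> L1 (fun y => k * p y).
Proof. by move=> ip; have := integrableZl measurableT k ip. Qed.

Lemma integrable_opp p : L1 p -> L1 (fun y => - p y).
Proof.
move=> /(integrable_scale (-1)); congr integrable.
by apply/funext => y /=; rewrite mulN1r.
Qed.

Let mcos k x : measurable_fun setT (fun y => cos (k * (y - x))).
Proof.
have m : measurable_fun setT (fun y => k * (y - x)).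
  by apply: measurable_funM => //; exact: measurable_funB.
exact: (measurableT_comp measurable_cos m).
Qed.

Let msin k x : measurable_fun setT (fun y => sin (k * (y - x))).
Proof.
have m : measurable_fun setT (fun y => k * (y - x)).
  by apply: measurable_funM => //; exact: measurable_funB.
exact: (measurableT_comp measurable_sin m).
Qed.

Let mphase x : measurable_fun setT (fun z : R * R => z.1 * (z.2 - x)).
Proof. by apply: measurable_funM => //; apply: measurable_funB. Qed.

Let mKcos x : measurable_fun setT (fun z : R * R => cos (z.1 * (z.2 - x))).
Proof. exact: (measurableT_comp measurable_cos (mphase x)). Qed.

Let mKsin x : measurable_fun setT (fun z : R * R => sin (z.1 * (z.2 - x))).
Proof. exact: (measurableT_comp measurable_sin (mphase x)). Qed.

Let icos p x k : L1 p -> L1 (fun y => p y * cos (k * (y - x))).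
Proof. by move=> ip; exact: (integrable_mul_bounded ip (mcos k x) (fun=> norm_cos_le1 _)). Qed.

Let isin p x k : L1 p -> L1 (fun y => p y * sin (k * (y - x))).
Proof. by move=> ip; exact: integrable_mul_bounded ip (msin k x) (fun=> norm_sin_le1 _). Qed.

(* Real and imaginary parts of the Fourier transform of [p + i q]. *)
Definition ft_re p q k := \int[mu]_y (p y * cos (k * y) - q y * sin (k * y)).
Definition ft_im p q k := \int[mu]_y (p y * sin (k * y) + q y * cos (k * y)).

Lemma Re_fourierL1 h k : Re (fourierL1 h k) = ft_re (Re \o h) (Im \o h) k.
Proof. by apply: eq_Rintegral => y _ /=; case: (h y). Qed.

Lemma Im_fourierL1 h k : Im (fourierL1 h k) = ft_im (Re \o h) (Im \o h) k.
Proof. by apply: eq_Rintegral => y _ /=; case: (h y). Qed.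

(** The pair [q], [- p] represents -i(p + iq), and Im w = Re(-i w). Integrability and measurability
    of imaginary parts thus follow from those of real parts. *)
Lemma ft_imE p q : ft_im p q = ft_re q (fun y => - p y).
Proof. by apply/funext => k; apply: eq_Rintegral => y _; ring. Qed.

Section Transform.
Variables (p q : R -> R) (e : R).
Hypotheses (ip : L1 p) (iq : L1 q) (e0 : 0 < e).

Let ft_re_integrable k : L1 (fun y => p y * cos (k * y) - q y * sin (k * y)).
Proof.
have := integrableB measurableT (icos 0 k ip) (isin 0 k iq).
by congr integrable; apply/funext => y /=; rewrite subr0 EFinB.
Qed.

Lemma ft_im_rot k : ft_im q (fun y => - p y) k = - ft_re p q k.
Proof.
rewrite -[RHS]mulN1r -RintegralZl//.
by apply: eq_Rintegral => y _; ring.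
Qed.

(** The left side is the real part of exp(-ikx) times the transform; bringing the phase under the
    integral gives exp(ik(y - x)). *)
Lemma ft_rotate x k : cos (k * x) * ft_re p q k + sin (k * x) * ft_im p q k =
  \int[mu]_y (p y * cos (k * (y - x))) - \int[mu]_y (q y * sin (k * (y - x))).
Proof.
have ic r : L1 r -> L1 (fun y => r y * cos (k * y)).
  move=> ir; have := icos 0 k ir; congr integrable.
  by apply/funext => y /=; rewrite subr0.
have isn r : L1 r -> L1 (fun y => r y * sin (k * y)).
  move=> ir; have := isin 0 k ir; congr integrable.
  by apply/funext => y /=; rewrite subr0.
have iB : L1 (fun y => p y * sin (k * y) + q y * cos (k * y)).
  by have := integrableD measurableT (isn _ ip) (ic _ iq).
rewrite -RintegralB//; [|exact: icos|exact: isin].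
rewrite /ft_re /ft_im -!RintegralZl// -RintegralD//.
- by apply: eq_Rintegral => y _; rewrite (mulrBr k) cosB sinB; ring.
- exact: integrable_scale.
- exact: integrable_scale.
Qed.

(** Fubini with the kernels cos and sin yields integrability and, at the same time, measurability in
    [k]. *)
Lemma integrable_ft_re : L1 (fun k => damping e k * ft_re p q k).
Proof.
have idp := integrable_damping e0.
have I1 := bounded_kernel_integrable1 idp ip ler01 (mKcos 0) (fun=> norm_cos_le1 _).
have I2 := bounded_kernel_integrable1 idp iq ler01 (mKsin 0) (fun=> norm_sin_le1 _).
have := integrableB measurableT I1 I2.
congr integrable; apply/funext => k /=.
have := ft_rotate 0 k; rewrite mulr0 cos0 sin0 mul1r mul0r addr0 => ->.
by rewrite mulrBr EFinB.
Qed.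

(** Measurability is inherited from the damped transform, since [damping (- e)] undoes
    [damping e]. *)
Lemma measurable_ft_re : measurable_fun setT (ft_re p q).
Proof.
have /measurable_int/measurable_EFinP m := integrable_ft_re.
have -> : ft_re p q = fun k => damping (- e) k * (damping e k * ft_re p q k).
  by apply/funext => k; rewrite mulrA -expRD mulNr opprK subrr expR0 mul1r.
apply: measurable_funM => //.
by apply: continuous_measurable_fun; exact: continuous_damping.
Qed.

End Transform.

(** The real part of the damped inversion identity. After Fubini the inner integral over [k] is the
    Poisson kernel for the cosine and 0 for the sine, so [q] disappears. The imaginary part is this
    lemma for the pair [q], [- p]. *)
Lemma ft_pairing p q e x : L1 p -> L1 q -> 0 < e ->
  \int[mu]_k (ft_re p q k * (damping e k * cos (k * x))) +
  \int[mu]_k (ft_im p q k * (damping e k * sin (k * x))) =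
  \int[mu]_y (p y * (2 * poisson e (y - x))).
Proof.
move=> ip iq e0.
have iNp : L1 (fun y => - p y) by exact: integrable_opp.
have mcx : measurable_fun setT (fun k => cos (k * x)).
  have := mcos x 0; congr measurable_fun; apply/funext => k.
  by rewrite subr0 mulrC.
have msx : measurable_fun setT (fun k => sin (k * x)).
  have := msin x 0; congr measurable_fun; apply/funext => k.
  by rewrite subr0 mulrC.
have I1 : L1 (fun k => ft_re p q k * (damping e k * cos (k * x))).
  have := integrable_mul_bounded (integrable_ft_re ip iq e0) mcx (fun=> norm_cos_le1 _).
  by congr integrable; apply/funext => k /=; congr EFin; ring.
have I2 : L1 (fun k => ft_im p q k * (damping e k * sin (k * x))).
  rewrite ft_imE.
  have := integrable_mul_bounded (integrable_ft_re iq iNp e0) msx (fun=> norm_sin_le1 _).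
  by congr integrable; apply/funext => k /=; congr EFin; ring.
rewrite -RintegralD//.
have idp := integrable_damping e0.
have J1 := bounded_kernel_integrable1 idp ip ler01 (mKcos x) (fun=> norm_cos_le1 _).
have J2 := bounded_kernel_integrable1 idp iq ler01 (mKsin x) (fun=> norm_sin_le1 _).
transitivity (\int[mu]_k (damping e k * \int[mu]_y (p y * cos (k * (y - x))) -
                          damping e k * \int[mu]_y (q y * sin (k * (y - x))))).
  by apply: eq_Rintegral => k _; rewrite -mulrBr -ft_rotate//; ring.
rewrite RintegralB//.
rewrite (bounded_kernel_fubini idp ip ler01 (mKcos x) (fun=> norm_cos_le1 _)).
rewrite (bounded_kernel_fubini idp iq ler01 (mKsin x) (fun=> norm_sin_le1 _)).
under eq_Rintegral do rewrite /= integral_damping_cos//.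
under [X in _ - X]eq_Rintegral do rewrite /= integral_damping_sin// mulr0.
by rewrite Rintegral_cst// mul0r subr0.
Qed.

End FourierPairing.

(** * Uniqueness and injectivity of the L^2 transform *)

Section FourierL2.
Context {R : realType}.
Local Notation mu := (@lebesgue_measure R).
Local Notation L1 f := (mu.-integrable setT (EFin \o f)).
Local Notation L2 f := (f \in Lfun mu 2%:E).
Local Notation Re := (@complex.Re R).
Local Notation Im := (@complex.Im R).
Implicit Types (e k x y : R) (f g p q b : R -> R) (h F : R -> R[i]).

Lemma ae_eq_Rintegral f g : measurable_fun setT f -> measurable_fun setT g ->
  {ae mu, forall x, f x = g x} -> \int[mu]_x f x = \int[mu]_x g x.
Proof.
move=> mf mg fg; congr fine; apply: ae_eq_integral => //.
- exact/measurable_EFinP.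
- exact/measurable_EFinP.
- move: fg; apply: filterS; first exact: (ae_filter_ringOfSetsType mu).
  by move=> x /= -> _.
Qed.

Lemma Lfun2_mul_bounded f b : L2 f -> measurable_fun setT b ->
  (forall y, `|b y| <= 1) -> L2 (fun y => f y * b y).
Proof.
move=> fL mb b1; have mf := Lfun_measurable fL.
have mfb : measurable_fun setT (fun y => f y * b y) by exact: measurable_funM.
apply: integrable_sqr_Lfun2 => //.
apply: (le_integrable measurableT _ _ (Lfun2_integrable_sqr fL)).
  by apply/measurable_EFinP; exact: measurable_funX.
move=> y _ /=; rewrite lee_fin !normrX lerXn2r ?nnegrE//.
by rewrite normrM ler_piMr.
Qed.

Lemma damping_Lfun2 e : 0 < e -> L2 (damping e).
Proof.
move=> e0.
have md : measurable_fun setT (damping e).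
  by apply: continuous_measurable_fun; exact: continuous_damping.
apply: integrable_sqr_Lfun2 => //.
apply: (le_integrable measurableT _ _ (integrable_damping e0)).
  by apply/measurable_EFinP; exact: measurable_funX.
move=> y _ /=; rewrite lee_fin expr2 normrM ler_piMr// ger0_norm ?damping_le1//.
exact/ltW/damping_gt0.
Qed.

Let mcos x : measurable_fun setT (fun k => cos (k * x)).
Proof.
have m : measurable_fun setT (fun k : R => k * x) by exact: measurable_funM.
exact: (measurableT_comp measurable_cos m).
Qed.

Let msin x : measurable_fun setT (fun k => sin (k * x)).
Proof.
have m : measurable_fun setT (fun k : R => k * x) by exact: measurable_funM.
exact: (measurableT_comp measurable_sin m).
Qed.

Let damping_cos_Lfun2 e x : 0 < e -> L2 (fun k => damping e k * cos (k * x)).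
Proof.
move=> e0; apply: Lfun2_mul_bounded => //; first exact: damping_Lfun2.
by move=> k; exact: norm_cos_le1.
Qed.

Let damping_sin_Lfun2 e x : 0 < e -> L2 (fun k => damping e k * sin (k * x)).
Proof.
move=> e0; apply: Lfun2_mul_bounded => //; first exact: damping_Lfun2.
by move=> k; exact: norm_sin_le1.
Qed.

Let poisson2_Lfun2 e x : 0 < e -> L2 (fun y => 2 * poisson e (y - x)).
Proof.
move=> e0.
have -> : (fun y => 2 * poisson e (y - x)) = (fun y => poisson e (y - x) * 2).
  by apply/funext => y; rewrite mulrC.
exact: (Lfun_scale 2 (ler1n R 2) (poisson_Lfun2 x e0)).
Qed.

Lemma le_Lnorm2 f g : measurable_fun setT f -> measurable_fun setT g ->
  (forall x, `|f x| <= `|g x|) ->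
  ('N[mu]_2%:E[EFin \o f] <= 'N[mu]_2%:E[EFin \o g])%E.
Proof.
move=> mf mg fg.
have mpow (r : R -> R) : measurable_fun setT r -> measurable_fun setT (fun x => (`|r x| `^ 2)%:E).
  move=> mr; apply/measurable_EFinP.
  apply: (@measurableT_comp _ _ _ _ _ _ (fun x : R => x `^ 2)) => //.
  exact: measurableT_comp.
rewrite unlock gt0_ler_poweR//.
- by rewrite in_itv/= leey andbT integral_ge0.
- by rewrite in_itv/= leey andbT integral_ge0.
- apply: ge0_le_integral => //=.
  + exact: mpow.
  + exact: mpow.
  + move=> x _; rewrite lee_fin ge0_ler_powR// nnegrE//.
Qed.

Local Notation cmeasurable := (@cmeasurable_fun R _ R setT).

Lemma cL2_cmeasurable h : cL2 h -> cmeasurable h.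
Proof. by case=> hr hi; split; [exact: Lfun_measurable hr|exact: Lfun_measurable hi]. Qed.

Let mnormc h F : cmeasurable h -> cmeasurable F ->
  measurable_fun setT (fun x => ComplexField.Normc.normc (h x - F x)).
Proof.
move=> [mhr mhi] [mFr mFi].
have -> : (fun x => ComplexField.Normc.normc (h x - F x)) =
  fun x => Num.sqrt ((Re (h x) - Re (F x)) ^+ 2 + (Im (h x) - Im (F x)) ^+ 2).
  by apply/funext => x; case: (h x) (F x) => [a b] [c d].
have ms : measurable_fun setT (@Num.sqrt R).
  by apply: continuous_measurable_fun; exact: sqrt_continuous.
apply: (measurableT_comp ms); apply: measurable_funD;
  by apply: measurable_funX; apply: measurable_funB.
Qed.

Lemma L2dist_ge_Re h F : cmeasurable h -> cmeasurable F ->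
  ('N[mu]_2%:E[EFin \o (fun x => Re (h x) - Re (F x))%R] <= L2dist h F)%E.
Proof.
move=> mh mF; apply: le_Lnorm2; last 2 first.
- exact: mnormc.
- move=> x; case: (h x) (F x) => [a b] [c d] /=.
  by rewrite [leRHS]ger0_norm ?sqrtr_ge0// -sqrtr_sqr ler_wsqrtr// lerDl sqr_ge0.
- by apply: measurable_funB; [case: mh|case: mF].
Qed.

Lemma L2dist_ge_Im h F : cmeasurable h -> cmeasurable F ->
  ('N[mu]_2%:E[EFin \o (fun x => Im (h x) - Im (F x))%R] <= L2dist h F)%E.
Proof.
move=> mh mF; apply: le_Lnorm2; last 2 first.
- exact: mnormc.
- move=> x; case: (h x) (F x) => [a b] [c d] /=.
  by rewrite [leRHS]ger0_norm ?sqrtr_ge0// -sqrtr_sqr ler_wsqrtr// lerDr sqr_ge0.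
- by apply: measurable_funB; [case: mh|case: mF].
Qed.

Section Approximation.
Variables (h_ : nat -> R -> R[i]) (h : R -> R[i]).
Hypotheses (mh_ : forall n, cmeasurable (h_ n)) (mh : cmeasurable h).
Hypothesis h_h : L2dist (h_ n) h @[n --> \oo] --> 0%E.

Lemma L2dist_cvg_Re :
  'N[mu]_2%:E[EFin \o (fun x => Re (h_ n x) - Re (h x))%R]%E @[n --> \oo] --> 0%E.
Proof.
apply: (squeeze_cvge _ _ h_h); last exact: cvg_cst.
by apply: nearW => n; rewrite Lnorm_ge0 L2dist_ge_Re.
Qed.

Lemma L2dist_cvg_Im :
  'N[mu]_2%:E[EFin \o (fun x => Im (h_ n x) - Im (h x))%R]%E @[n --> \oo] --> 0%E.
Proof.
apply: (squeeze_cvge _ _ h_h); last exact: cvg_cst.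
by apply: nearW => n; rewrite Lnorm_ge0 L2dist_ge_Im.
Qed.
End Approximation.

(** The two conjuncts are the real and imaginary parts of one complex identity, obtained for the
    approximants and carried over by six limits of pairings. *)
Lemma fourierL2_pairing h F e x : is_fourierL2 h F -> 0 < e ->
  \int[mu]_k (Re (F k) * (damping e k * cos (k * x))) +
  \int[mu]_k (Im (F k) * (damping e k * sin (k * x))) =
    \int[mu]_y (Re (h y) * (2 * poisson e (y - x))) /\
  \int[mu]_k (Im (F k) * (damping e k * cos (k * x))) -
  \int[mu]_k (Re (F k) * (damping e k * sin (k * x))) =
    \int[mu]_y (Im (h y) * (2 * poisson e (y - x))).
Proof.
move=> [hL FL [h_ [h_L h_h F_F]]] e0.
have ip n : L1 (Re \o h_ n) by have [[/Lfun1_integrable]] := h_L n.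
have iq n : L1 (Im \o h_ n) by have [[_ /Lfun1_integrable]] := h_L n.
have iNp n : L1 (fun y => - (Re \o h_ n) y) by exact: integrable_opp.
have ReF n : Re \o fourierL1 (h_ n) = ft_re (Re \o h_ n) (Im \o h_ n).
  by apply/funext => k; exact: Re_fourierL1.
have ImF n : Im \o fourierL1 (h_ n) = ft_im (Re \o h_ n) (Im \o h_ n).
  by apply/funext => k; exact: Im_fourierL1.
have mh_ n : cmeasurable (h_ n) by have [_ /cL2_cmeasurable] := h_L n.
have mF_ n : cmeasurable (fourierL1 (h_ n)).
  split; first by rewrite ReF; exact: measurable_ft_re ltr01.
  by rewrite ImF ft_imE; exact: measurable_ft_re ltr01.
have mh := cL2_cmeasurable hL; have mF := cL2_cmeasurable FL.
have [hrL hiL] := hL; have [FrL FiL] := FL.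
have cL := damping_cos_Lfun2 x e0; have sL := damping_sin_Lfun2 x e0.
have pL := poisson2_Lfun2 x e0.
(* These pairings are integrable because the damped transform is in L^1, not through
   Cauchy-Schwarz. *)
have iReF n (b : R -> R) : measurable_fun setT b -> (forall k, `|b k| <= 1) ->
    L1 (fun k => (Re \o fourierL1 (h_ n)) k * (damping e k * b k)).
  move=> mb b1; rewrite ReF.
  have := integrable_mul_bounded (integrable_ft_re (ip n) (iq n) e0) mb b1.
  by congr integrable; apply/funext => k /=; congr EFin; ring.
have iImF n (b : R -> R) : measurable_fun setT b -> (forall k, `|b k| <= 1) ->
    L1 (fun k => (Im \o fourierL1 (h_ n)) k * (damping e k * b k)).
  move=> mb b1; rewrite ImF ft_imE.
  have := integrable_mul_bounded (integrable_ft_re (iq n) (iNp n) e0) mb b1.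
  by congr integrable; apply/funext => k /=; congr EFin; ring.
have hr_L n : L2 (Re \o h_ n) by have [_ []] := h_L n.
have hi_L n : L2 (Im \o h_ n) by have [_ []] := h_L n.
have h_r := Lfun2_pairing_cvg (fun n => (mh_ n).1)
  (fun n => Lfun2_mul_integrable (hr_L n) pL) hrL pL (L2dist_cvg_Re mh_ mh h_h).
have h_i := Lfun2_pairing_cvg (fun n => (mh_ n).2)
  (fun n => Lfun2_mul_integrable (hi_L n) pL) hiL pL (L2dist_cvg_Im mh_ mh h_h).
have F_rc := Lfun2_pairing_cvg (fun n => (mF_ n).1)
  (fun n => iReF n _ (mcos x) (fun=> norm_cos_le1 _)) FrL cL (L2dist_cvg_Re mF_ mF F_F).
have F_rs := Lfun2_pairing_cvg (fun n => (mF_ n).1)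
  (fun n => iReF n _ (msin x) (fun=> norm_sin_le1 _)) FrL sL (L2dist_cvg_Re mF_ mF F_F).
have F_ic := Lfun2_pairing_cvg (fun n => (mF_ n).2)
  (fun n => iImF n _ (mcos x) (fun=> norm_cos_le1 _)) FiL cL (L2dist_cvg_Im mF_ mF F_F).
have F_is := Lfun2_pairing_cvg (fun n => (mF_ n).2)
  (fun n => iImF n _ (msin x) (fun=> norm_sin_le1 _)) FiL sL (L2dist_cvg_Im mF_ mF F_F).
have E_r n : \int[mu]_y ((Re \o h_ n) y * (2 * poisson e (y - x))) =
    \int[mu]_k ((Re \o fourierL1 (h_ n)) k * (damping e k * cos (k * x))) +
    \int[mu]_k ((Im \o fourierL1 (h_ n)) k * (damping e k * sin (k * x))).
  by rewrite -(ft_pairing x (ip n) (iq n) e0) -ReF -ImF.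
(* This is [ft_pairing] for -i times [h_ n], whose real part is the imaginary part of [h_ n]. *)
have E_i n : \int[mu]_y ((Im \o h_ n) y * (2 * poisson e (y - x))) =
    \int[mu]_k ((Im \o fourierL1 (h_ n)) k * (damping e k * cos (k * x))) -
    \int[mu]_k ((Re \o fourierL1 (h_ n)) k * (damping e k * sin (k * x))).
  rewrite -(ft_pairing x (iq n) (iNp n) e0) -ft_imE -ImF; congr (_ + _).
  rewrite -mulN1r -RintegralZl//; last first.
    by apply: iReF => // k; exact: norm_sin_le1.
  by apply: eq_Rintegral => k _; rewrite ft_im_rot// ReF; ring.
split.
- apply: (cvg_unique _ (cvgD F_rc F_is)) => //.
  by apply: cvg_trans h_r; apply: near_eq_cvg; apply: nearW => n; exact: E_r.
- apply: (cvg_unique _ (cvgB F_ic F_rs)) => //.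
  by apply: cvg_trans h_i; apply: near_eq_cvg; apply: nearW => n; exact: E_i.
Qed.

Lemma Lfun2_pairingB f g b : L2 f -> L2 g -> L2 b ->
  \int[mu]_k ((f k - g k) * b k) =
  \int[mu]_k (f k * b k) - \int[mu]_k (g k * b k).
Proof.
move=> fL gL bL; rewrite -RintegralB//; [|exact: Lfun2_mul_integrable..].
by apply: eq_Rintegral => k _; ring.
Qed.

Lemma ae_eq_comp (T U : Type) (c : T -> U) (u v : R -> T) :
  {ae mu, forall x, u x = v x} -> {ae mu, forall x, c (u x) = c (v x)}.
Proof.
apply: filterS; first exact: (ae_filter_ringOfSetsType mu).
by move=> x ->.
Qed.

Lemma ae_eq_Lfun2_pairing f g b : L2 f -> L2 g -> L2 b ->
  {ae mu, forall x, f x = g x} ->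
  \int[mu]_y (f y * b y) = \int[mu]_y (g y * b y).
Proof.
move=> fL gL bL fg; have mb := Lfun_measurable bL.
apply: ae_eq_Rintegral.
- by apply: measurable_funM => //; exact: Lfun_measurable fL.
- by apply: measurable_funM => //; exact: Lfun_measurable gL.
- move: fg; apply: filterS; first exact: (ae_filter_ringOfSetsType mu).
  by move=> y ->.
Qed.

Lemma ae_eq0_of_poisson2 f : L2 f ->
  (forall e x, 0 < e -> \int[mu]_y (f y * (2 * poisson e (y - x))) = 0) ->
  {ae mu, forall x, f x = 0}.
Proof.
move=> fL f0; apply: ae_eq0_of_poisson => // e x e0; have := f0 e x e0.
have -> : \int[mu]_y (f y * (2 * poisson e (y - x))) =
          2 * \int[mu]_y (f y * poisson e (y - x)).
  rewrite -RintegralZl//; last by apply: Lfun2_mul_integrable => //; exact: poisson_Lfun2.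
  by apply: eq_Rintegral => y _; ring.
by move/eqP; rewrite mulf_eq0 pnatr_eq0/= => /eqP.
Qed.

Lemma ae_eq_of_Re_Im (u v : R -> R[i]) :
  {ae mu, forall x, Re (u x) - Re (v x) = 0} ->
  {ae mu, forall x, Im (u x) - Im (v x) = 0} -> {ae mu, forall x, u x = v x}.
Proof.
apply: filterS2; first exact: (ae_filter_ringOfSetsType mu).
move=> x; case: (u x) (v x) => [a b] [c d] /= /eqP + /eqP.
by rewrite !subr_eq0 => /eqP -> /eqP ->.
Qed.

(* The transforms of a common function differ by [G] with
   [\int G(k) exp(-e|k|) exp(-ikx) dk = 0] for all [x]: the integrable function
   [G(k) exp(-e|k|)] has zero Fourier transform, so its Poisson integrals vanish. *)
Lemma fourierL2_unique h1 h2 F1 F2 : is_fourierL2 h1 F1 -> is_fourierL2 h2 F2 ->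
  {ae mu, forall x, h1 x = h2 x} -> {ae mu, forall k, F1 k = F2 k}.
Proof.
move=> hF1 hF2 h12.
have [[h1r h1i] [F1r F1i] _] := hF1; have [[h2r h2i] [F2r F2i] _] := hF2.
have d0 : 0 < (1 : R) by [].
pose gr k := Re (F1 k) - Re (F2 k); pose gi k := Im (F1 k) - Im (F2 k).
have grL : L2 gr by exact: Lfun2B.
have giL : L2 gi by exact: Lfun2B.
have mdamp : measurable_fun setT (damping (1 : R)).
  by apply: continuous_measurable_fun; exact: continuous_damping.
have ndamp k : `|damping (1 : R) k| <= 1.
  by rewrite ger0_norm ?damping_le1// ltW// damping_gt0.
(* The damping makes the difference integrable besides square-integrable, so that [ft_pairing]
   applies to it; being positive, it can be divided out at the end. *)
pose p k := gr k * damping 1 k; pose q k := gi k * damping 1 k.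
have pL : L2 p by exact: Lfun2_mul_bounded.
have qL : L2 q by exact: Lfun2_mul_bounded.
have ip : L1 p by apply: Lfun2_mul_integrable => //; exact: damping_Lfun2.
have iq : L1 q by apply: Lfun2_mul_integrable => //; exact: damping_Lfun2.
have hr x : \int[mu]_y (Re (h1 y) * (2 * poisson 1 (y - x))) =
            \int[mu]_y (Re (h2 y) * (2 * poisson 1 (y - x))).
  exact: ae_eq_Lfun2_pairing h1r h2r (poisson2_Lfun2 x d0) (ae_eq_comp Re h12).
have hi x : \int[mu]_y (Im (h1 y) * (2 * poisson 1 (y - x))) =
            \int[mu]_y (Im (h2 y) * (2 * poisson 1 (y - x))).
  exact: ae_eq_Lfun2_pairing h1i h2i (poisson2_Lfun2 x d0) (ae_eq_comp Im h12).
have iNq : L1 (fun k => - q k) by exact: integrable_opp.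
have iNp : L1 (fun k => - p k) by exact: integrable_opp.
(* The pairings carry exp(-ikx), while the transform carries exp(ikx). Conjugation reconciles the
   two: the transform of p - iq is the conjugate of the integral of (p + iq) exp(-ikx). *)
have re0 x : ft_re p (fun k => - q k) x = 0.
  have [E1 _] := fourierL2_pairing x hF1 d0; have [E2 _] := fourierL2_pairing x hF2 d0.
  have cL := damping_cos_Lfun2 x d0; have sL := damping_sin_Lfun2 x d0.
  have <- : \int[mu]_k (gr k * (damping 1 k * cos (k * x))) +
            \int[mu]_k (gi k * (damping 1 k * sin (k * x))) = 0.
    by rewrite !Lfun2_pairingB// addrACA -opprD E1 hr -E2 subrr.
  rewrite -RintegralD//; [|exact: Lfun2_mul_integrable..].
  by apply: eq_Rintegral => k _; rewrite /p /q (mulrC x); ring.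
have im0 x : ft_im p (fun k => - q k) x = 0.
  have [_ E1] := fourierL2_pairing x hF1 d0; have [_ E2] := fourierL2_pairing x hF2 d0.
  have cL := damping_cos_Lfun2 x d0; have sL := damping_sin_Lfun2 x d0.
  have E0 : \int[mu]_k (gi k * (damping 1 k * cos (k * x))) -
            \int[mu]_k (gr k * (damping 1 k * sin (k * x))) = 0.
    by rewrite !Lfun2_pairingB// opprD addrACA -opprD E1 hi -E2 subrr.
  rewrite -[RHS]oppr0 -E0 opprB -RintegralB//; [|exact: Lfun2_mul_integrable..].
  by apply: eq_Rintegral => k _; rewrite /p /q (mulrC x); ring.
have p0 : {ae mu, forall k, p k = 0}.
  apply: ae_eq0_of_poisson2 => // e x e0.
  rewrite -(ft_pairing x ip iNq e0).
  under eq_Rintegral do rewrite re0 mul0r.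
  under [X in _ + X]eq_Rintegral do rewrite im0 mul0r.
  by rewrite Rintegral_cst// mul0r addr0.
(* The pair [q], [p] represents i(p - iq), so its transform vanishes as well, and [q] is now the
   real part. *)
have q0 : {ae mu, forall k, q k = 0}.
  apply: ae_eq0_of_poisson2 => // e x e0.
  rewrite -(ft_pairing x iq ip e0).
  have r0 k : ft_re q p k = 0.
    by apply: oppr_inj; rewrite -(ft_im_rot iq ip) im0 oppr0.
  have i0 k : ft_im q p k = 0.
    by rewrite -(re0 k); apply: eq_Rintegral => y _; ring.
  under eq_Rintegral do rewrite r0 mul0r.
  under [X in _ + X]eq_Rintegral do rewrite i0 mul0r.
  by rewrite Rintegral_cst// mul0r addr0.
apply: ae_eq_of_Re_Im.
- move: p0; apply: filterS; first exact: (ae_filter_ringOfSetsType mu).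
  by move=> k /eqP; rewrite mulf_eq0 (gt_eqF (damping_gt0 _ _)) orbF => /eqP.
- move: q0; apply: filterS; first exact: (ae_filter_ringOfSetsType mu).
  by move=> k /eqP; rewrite mulf_eq0 (gt_eqF (damping_gt0 _ _)) orbF => /eqP.
Qed.

Lemma fourierL2_injective h1 h2 F1 F2 : is_fourierL2 h1 F1 -> is_fourierL2 h2 F2 ->
  {ae mu, forall k, F1 k = F2 k} -> {ae mu, forall x, h1 x = h2 x}.
Proof.
move=> hF1 hF2 F12.
have [[h1r h1i] [F1r F1i] _] := hF1; have [[h2r h2i] [F2r F2i] _] := hF2.
have FRe := ae_eq_comp Re F12; have FIm := ae_eq_comp Im F12.
apply: ae_eq_of_Re_Im; apply: ae_eq0_of_poisson2 => [|e x e0].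
- exact: Lfun2B.
- have pL := poisson2_Lfun2 x e0.
  have cL := damping_cos_Lfun2 x e0; have sL := damping_sin_Lfun2 x e0.
  rewrite (Lfun2_pairingB h1r h2r)//.
  have [<- _] := fourierL2_pairing x hF1 e0; have [<- _] := fourierL2_pairing x hF2 e0.
  rewrite (ae_eq_Lfun2_pairing F1r F2r cL)// (ae_eq_Lfun2_pairing F1i F2i sL)//.
  by rewrite subrr.
- exact: Lfun2B.
- have pL := poisson2_Lfun2 x e0.
  have cL := damping_cos_Lfun2 x e0; have sL := damping_sin_Lfun2 x e0.
  rewrite (Lfun2_pairingB h1i h2i)//.
  have [_ <-] := fourierL2_pairing x hF1 e0; have [_ <-] := fourierL2_pairing x hF2 e0.
  rewrite (ae_eq_Lfun2_pairing F1r F2r sL)// (ae_eq_Lfun2_pairing F1i F2i cL)//.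
  by rewrite subrr.
Qed.

End FourierL2.

(** * Uniqueness for the scalar linear equation at a fixed frequency *)

Section LinearODE.
Context {R : realType}.
Local Notation Re := (@complex.Re R).
Local Notation Im := (@complex.Im R).

(* [exp(-2rt)(a^2 + b^2)] is constant, [r] being the real part of the rate. *)
Lemma rotation_ode_unique (a b : R -> R) (r s t : R) : 0 <= t ->
  {within `[0, +oo[, continuous a} -> {within `[0, +oo[, continuous b} ->
  (forall x : R, 0 < x -> is_derive x 1 a (r * a x - s * b x)) ->
  (forall x : R, 0 < x -> is_derive x 1 b (r * b x + s * a x)) ->
  a 0 = 0 -> b 0 = 0 -> a t = 0 /\ b t = 0.
Proof.
rewrite le_eqVlt => /predU1P[<- _ _ _ _ //|t0 ca cb da db a0 b0].
pose w x := expR (- 2 * r * x) * (a x ^+ 2 + b x ^+ 2).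
have sE (x y : R^o) : x *: y = x * y by [].
have dw (x : R) : x \in `]0, t[ -> is_derive x 1 w 0.
  rewrite in_itv/= => /andP[x0 _]; have dax := da x x0; have dbx := db x x0.
  by rewrite /w; apply: is_derive_eq; rewrite !sE /=; ring.
have sub : `[0, t]%classic `<=` `[0, +oo[%classic.
  by move=> x /=; rewrite !in_itv/= andbT => /andP[].
have cw : {within `[0, t], continuous w}.
  have ca' := continuous_subspaceW sub ca; have cb' := continuous_subspaceW sub cb.
  have ce : {within `[0, t], continuous (fun x : R => expR (- 2 * r * x))}.
    apply: continuous_subspaceT => x.
    apply: (@continuous_comp _ _ _ (fun x => - 2 * r * x) (@expR R)).
      by apply: cvgM; [exact: cvg_cst|exact: cvg_id].
    exact: continuous_expR.
  move=> x; apply: cvgM; first exact: ce.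
  by apply: cvgD; apply: cvgM; [exact: ca'|exact: ca'|exact: cb'|exact: cb'].
(* The mean value theorem needs the derivative only inside the interval, which matches an equation
   valid for positive times together with continuity at 0. *)
have [c _] := MVT t0 dw cw.
rewrite mul0r => /eqP; rewrite subr_eq0 {2}/w a0 b0 expr0n/= addr0 mulr0.
rewrite mulf_eq0 gt_eqF ?expR_gt0//= paddr_eq0 ?sqr_ge0// !sqrf_eq0.
by move=> /andP[/eqP -> /eqP ->].
Qed.

(** The source cancels in the difference, whose real and imaginary parts solve the preceding real
    system with [r] and [s] the real and imaginary parts of [l]. *)
Lemma linear_ode_unique (u1 u2 : R -> R[i]) (l g : R[i]) (t : R) : 0 <= t ->
  ccontinuous_on `[0, +oo[ u1 -> ccontinuous_on `[0, +oo[ u2 ->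
  (forall x : R, 0 < x -> is_cderive x u1 (l * u1 x + g)) ->
  (forall x : R, 0 < x -> is_cderive x u2 (l * u2 x + g)) ->
  u1 0 = u2 0 -> u1 t = u2 t.
Proof.
move=> t0 [c1r c1i] [c2r c2i] d1 d2 u0.
have [Er Ei] : Re (u1 t) - Re (u2 t) = 0 /\ Im (u1 t) - Im (u2 t) = 0.
  apply: (@rotation_ode_unique (fun x => Re (u1 x) - Re (u2 x))
    (fun x => Im (u1 x) - Im (u2 x)) (Re l) (Im l)) => //.
  - by move=> x; apply: cvgB; [exact: c1r|exact: c2r].
  - by move=> x; apply: cvgB; [exact: c1i|exact: c2i].
  - move=> x x0; have [D1 _] := d1 x x0; have [D2 _] := d2 x x0.
    have D := is_deriveB D1 D2; apply: (is_derive_eq D).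
    by case: l (u1 x) (u2 x) g {d1 d2 D D1 D2} => [? ?] [? ?] [? ?] [? ?] /=; ring.
  - move=> x x0; have [_ D1] := d1 x x0; have [_ D2] := d2 x x0.
    have D := is_deriveB D1 D2; apply: (is_derive_eq D).
    by case: l (u1 x) (u2 x) g {d1 d2 D D1 D2} => [? ?] [? ?] [? ?] [? ?] /=; ring.
  - by rewrite u0 subrr.
  - by rewrite u0 subrr.
move: Er Ei; case: (u1 t) (u2 t) => [a b] [c d] /= /eqP + /eqP.
by rewrite !subr_eq0 => /eqP -> /eqP ->.
Qed.

End LinearODE.

Theorem theorem3p2p1 (R : realType) (alpha theta nu d : R)
    (halpha : 1 < alpha <= 2)
    (htheta : `|theta| <= Num.min alpha (2 - alpha))
    (hd : 0 < d)
    (g0 f1 f2 : R -> R)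
    (hg0 : g0 \in Lfun (@lebesgue_measure R) 2%:E)
    (hf1 : f1 \in Lfun (@lebesgue_measure R) 2%:E)
    (hf2 : f2 \in Lfun (@lebesgue_measure R) 2%:E)
    (u1 u2 : R -> R -> R[i])
    (hu1 : fourier_solution alpha theta nu d
             (fun x => (g0 x)%:C) (fun x => (f1 x)%:C) u1)
    (hu2 : fourier_solution alpha theta nu d
             (fun x => (g0 x)%:C) (fun x => (f2 x)%:C) u2)
    (hf : {ae @lebesgue_measure R, forall x, f1 x = f2 x}) :
  forall t : R, 0 <= t ->
    {ae @lebesgue_measure R, forall x, u1 x t = u2 x t}.
Proof.
move=> t t0.
have [_ _ [v1 [g1 [F1 [[G1 H1] _ V1 O1]]]]] := hu1.
have [_ _ [v2 [g2 [F2 [[G2 H2] _ V2 O2]]]]] := hu2.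
(* The transforms are chosen separately in the two solutions, so even the common initial datum needs
   [fourierL2_unique]. *)
have g12 : {ae @lebesgue_measure R, forall k, g1 k = g2 k}.
  by apply: fourierL2_unique G1 G2 _; exact: aeW.
have F12 : {ae @lebesgue_measure R, forall k, F1 k = F2 k}.
  by apply: fourierL2_unique H1 H2 _; exact: (ae_eq_comp (fun y => y%:C) hf).
apply: fourierL2_injective (V1 t t0) (V2 t t0) _.
have : {ae @lebesgue_measure R, forall k, g1 k = g2 k /\ F1 k = F2 k}.
  move: g12 F12; apply: filterS2; first exact: (ae_filter_ringOfSetsType (@lebesgue_measure R)).
  by move=> k.
move: O1 O2; apply: filterS3; first exact: (ae_filter_ringOfSetsType (@lebesgue_measure R)).
move=> k [c1 d1 i1] [c2 d2 i2] [g12k F12k].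
apply: (linear_ode_unique t0 c1 c2 d1); last by rewrite i1 i2.
by rewrite F12k.
Qed.
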